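(* Let $A, B \in \mathbb{C}$ with $A = re^{i\theta}$, where $r > 0$ and $\theta \in \mathbb{R}$. Then the solution set of the inequality $AZ - B \geq 0$ is $$\{Z \in \mathbb{C} : AZ - B \geq 0\} = e^{-i\theta}\,\mathscr{D}(B/r).$$
   Context: The relation $\geq$ on $\mathbb{C}$ is defined as follows: for $A = a_1 + a_2 i$, $B = b_1 + b_2 i$ with $a_1,a_2,b_1,b_2 \in \mathbb{R}$, $A \geq B$ means: $a_1 > b_1$, or ($a_1 = b_1$ and $a_2 \geq b_2$). For $A \in \mathbb{C}$, $\mathscr{D}(A) := \{Z \in \mathbb{C} : Z \geq A\}$. For $\mathscr{B} \subset \mathbb{C}$ and $\theta \in \mathbb{R}$, the rotation set is $e^{i\theta}\mathscr{B} := \{Ze^{i\theta} : Z \in \mathscr{B}\}$. *)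

(* Defs.v *)
From HB Require Import structures.
From mathcomp Require Import all_boot all_order all_algebra.
From mathcomp Require Import all_classical all_reals all_analysis.
From mathcomp Require Import complex.

Set Implicit Arguments.
Unset Strict Implicit.
Unset Printing Implicit Defensive.

Import Order.TTheory GRing.Theory Num.Theory.

Local Open Scope classical_set_scope.
Local Open Scope ring_scope.
Local Open Scope complex_scope.

(* The lexicographic total order on the complex numbers. It is not the
   canonical order of R[i], written [<=], which only compares numbers with the
   same imaginary part; hence a separate relation. *)
Definition cge (R : realType) (A B : R[i]) : Prop :=
  let: a1 +i* a2 := A in let: b1 +i* b2 := B in
  a1 > b1 \/ (a1 = b1 /\ a2 >= b2).

Notation "A '>=c' B" := (cge A B) (at level 70, no associativity).

Definition Dset (R : realType) (A : R[i]) : set R[i] := [set Z | Z >=c A].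

(* e^(i theta), by Euler's formula. *)
Definition expi (R : realType) (theta : R) : R[i] := cos theta +i* sin theta.

Definition rotation (R : realType) (theta : R) (S : set R[i]) : set R[i] :=
  [set Z * expi theta | Z in S].

(* Main.v *)
Require Import Defs.
From mathcomp Require Import all_boot all_order all_algebra.
From mathcomp Require Import all_classical all_reals all_analysis.
From mathcomp Require Import complex.

(** The lexicographic order on complex numbers is invariant under translation
    ([cge_subr0]) and under multiplication by a positive real
    ([cge_pmul2l]), because both act on real and imaginary parts separately
    and preserve the order of each. It is not invariant under rotation, so the
    rotation is moved onto the unknown instead: with [W = Z * expi theta] the
    inequality reads [r W - B >= 0], that is [W >= B / r], and [Z] is recovered
    as [W * expi (- theta)] because the two exponentials are mutually inverse
    ([expiNK]). *)

Import Order.TTheory GRing.Theory Num.Theory.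

Local Open Scope classical_set_scope.
Local Open Scope ring_scope.
Local Open Scope complex_scope.

Lemma expiNK (R : realType) (theta : R) : expi theta * expi (- theta) = 1.
Proof.
rewrite /expi cosN sinN; apply/eqP; rewrite eq_complex /=.
by rewrite !mulrN opprK -!expr2 cos2Dsin2 mulrC addrC subrr !eqxx.
Qed.

Lemma cge_subr0 (R : realType) (A B : R[i]) : (A - B >=c 0) <-> (A >=c B).
Proof.
case: A B => [a1 a2] [b1 b2] /=; rewrite subr_gt0 subr_ge0.
by split=> -[? | [/eqP]]; [left | rewrite subr_eq0 => /eqP; right
                          | left | rewrite -subr_eq0 => /eqP; right].
Qed.

Lemma cge_pmul2l (R : realType) (r : R) (A B : R[i]) : 0 < r ->
  (r%:C * A >=c r%:C * B) <-> (A >=c B).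
Proof.
case: A B => [a1 a2] [b1 b2] r_gt0 /=.
rewrite !mul0r !subr0 !addr0 ltr_pM2l // ler_pM2l //.
have rI : injective (fun x => r * x) by apply: mulfI; rewrite gt_eqF.
by split=> -[? | [/eqP]]; [left | rewrite (inj_eq rI) => /eqP; right
                          | left | rewrite -(inj_eq rI) => /eqP; right].
Qed.

Theorem mainTheorem9 (R : realType) (A B : R[i]) (r theta : R)
    (r_gt0 : 0 < r) (A_polar : A = r%:C * expi theta) :
  [set Z : R[i] | A * Z - B >=c 0] = rotation (- theta) (Dset (B / r%:C)).
Proof.
have rC_neq0 : r%:C != 0 by rewrite eq_complex /= eqxx andbT gt_eqF.
have solP W : (r%:C * W - B >=c 0) <-> (W >=c B / r%:C).
  by rewrite cge_subr0 -(cge_pmul2l _ r W) // [_ * (B / _)]mulrC divfK.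
apply/seteqP; split=> [Z /= | _ /= [W W_ge <-]]; rewrite A_polar -mulrA.
  move=> /solP W_ge; exists (expi theta * Z) => //.
  by rewrite mulrAC expiNK mul1r.
by apply/solP; rewrite mulrCA expiNK mulr1.
Qed.
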